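(* Let $A$ be a real constant $n\times n$ matrix and $B=A^{T}$. Suppose $\lambda$ is an eigenvalue of the matrix $B$ with elementary divisor of multiplicity $m\geq2$, corresponding to an eigenvector $\nu^{0}$ and to generalized eigenvectors $\nu^{k}$ of order $k$, $k=1,\dots,m-1$. Then the system $\dfrac{dx}{dt}=Ax$ has, on a domain $\mathscr X\subset\{x\colon\nu^{0}x\neq0\}$, the functionally independent autonomous first integrals $$F_\zeta\colon x\mapsto\Psi_\zeta(x)\quad\text{for all }x\in\mathscr X,\quad \zeta=2,\dots,m-1,$$ where the functions $\Psi_\zeta\colon\mathscr X\to\mathbb R$, $\zeta=2,\dots,m-1$, are (together with $\Psi_1$) the solution of the functional system $$\nu^{k}x=\sum_{\tau=1}^{k}\binom{k-1}{\tau-1}\Psi_\tau(x)\,\nu^{k-\tau}x\quad\text{for all }x\in\mathscr X,\quad k=1,\dots,m-1.$$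
   Context: A domain is an open arcwise connected set. For a vector $\nu=(\nu_1,\dots,\nu_n)$ and $x\in\mathbb R^n$, $\nu x=\sum_{\xi=1}^n\nu_\xi x_\xi$. If $\nu^{0}$ is an eigenvector of $B$ ($B\nu^0=\lambda\nu^0$, $\nu^0\ne0$) for the eigenvalue $\lambda$ with elementary divisor of multiplicity $m$, a non-zero vector $\nu^{k}\in\mathbb C^n$ is called a generalized eigenvector of order $k$ if $(B-\lambda E)\nu^{k}=k\,\nu^{k-1}$, $k=1,\dots,m-1$, where $E$ is the identity matrix (vectors regarded as columns). An autonomous first integral of $dx/dt=Ax$ on a domain $\mathscr X\subset\mathbb R^n$ is a continuously differentiable function $F\colon\mathscr X\to\mathbb R$ with $\sum_{\xi=1}^n (Ax)_\xi\,\partial_{x_\xi}F(x)=0$ for all $x\in\mathscr X$. The theorem is asserted both for a real eigenvalue $\lambda$ and for a complex eigenvalue $\lambda$ (${\rm Im}\,\lambda\neq0$); in the complex case the functions $\Psi_\zeta$ are complex-valued and the $F_\zeta$ are complex-valued first integrals (same identity), whose real and imaginary parts are real first integrals. *)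

(* Defs.v *)
(* MathComp-Analysis, over an arbitrary R : realType; complex numbers are R[i]
   from mathcomp-real-closed. *)
From mathcomp Require Import all_boot all_order all_algebra.
From mathcomp Require Import all_classical all_reals all_analysis.
From mathcomp Require Import complex.

Set Implicit Arguments.
Unset Strict Implicit.
Unset Printing Implicit Defensive.

Import Order.TTheory GRing.Theory Num.Theory.
Import numFieldNormedType.Exports.

Local Open Scope classical_set_scope.
Local Open Scope ring_scope.

(** * Linear algebra, over a field K used both with R and with R[i] *)

(* ('X - lambda)^m is an elementary divisor of B: it is the exact power of
   'X - lambda in some invariant polynomial d_i of B, the d_i being read off
   the Smith normal form of the characteristic matrix 'X * E - B. *)
Definition elementary_divisor (K : fieldType) (n : nat) (B : 'M[K]_n)
    (lambda : K) (m : nat) : Prop :=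
  exists (P Q : 'M[{poly K}]_n) (d : 'rV[{poly K}]_n),
    [/\ P \in unitmx, Q \in unitmx & P *m char_poly_mx B *m Q = diag_mx d] /\
    [/\ forall i, d 0 i \is monic,
        forall i j : 'I_n, (i <= j)%N -> d 0 i %| d 0 j,
        (0 < m)%N &
        exists i, mup lambda (d 0 i) = m].

(* nu 0 is an eigenvector and nu k a generalized eigenvector of order k for
   0 < k < m; the values nu k with m <= k are irrelevant.  The factor k on the
   right-hand side is part of the convention. *)
Definition generalized_eigenvectors (K : fieldType) (n : nat) (B : 'M[K]_n)
    (lambda : K) (m : nat) (nu : nat -> 'cV[K]_n) : Prop :=
  [/\ nu 0%N != 0,
      B *m nu 0%N = lambda *: nu 0%N &
      forall k, (0 < k < m)%N ->
        nu k != 0 /\ (B - lambda%:M) *m nu k = k%:R *: nu k.-1].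

(* The bilinear (not sesquilinear) product sum_xi nu_xi x_xi *)
Definition lform (K : fieldType) (n : nat) (nu x : 'cV[K]_n) : K :=
  \sum_(j < n) nu j 0 * x j 0.

(* l k x stands for nu^k x *)
Definition functional_system (K : fieldType) (T : Type) (X : set T) (m : nat)
    (l Psi : nat -> T -> K) : Prop :=
  forall x, X x -> forall k, (1 <= k < m)%N ->
    l k x = \sum_(1 <= tau < k.+1)
              'C(k.-1, tau.-1)%:R * Psi tau x * l (k - tau)%N x.

(* As nu^0 x does not vanish on X, a solution is determined on X; outside X
   and for indices not in {1, ..., m-1} it is arbitrary. *)
Definition unique_solution (K : fieldType) (T : Type) (X : set T) (m : nat)
    (l Psi : nat -> T -> K) : Prop :=
  functional_system X m l Psi /\
  forall Phi, functional_system X m l Phi ->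
    forall x, X x -> forall k, (1 <= k < m)%N -> Phi k x = Psi k x.

(** * Domains and first integrals in R^n *)

Definition arcwise_connected (R : realType) (n : nat) (X : set 'cV[R]_n)
    : Prop :=
  forall x y, X x -> X y ->
    exists gamma : R -> 'cV[R]_n,
      [/\ {within `[0, 1], continuous gamma},
          gamma 0 = x, gamma 1 = y &
          forall t, 0 <= t <= 1 -> X (gamma t)].

Definition domain (R : realType) (n : nat) (X : set 'cV[R]_n) : Prop :=
  open X /\ arcwise_connected X.

(* Functions on X are total functions on 'cV[R]_n; X being open, the notions
   below depend only on their values on X. *)

Definition pderiv (R : realType) (n : nat) (F : 'cV[R]_n -> R) (j : 'I_n)
    (x : 'cV[R]_n) : R :=
  'D_(delta_mx j 0) F x.

Definition continuously_differentiable (R : realType) (n : nat)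
    (X : set 'cV[R]_n) (F : 'cV[R]_n -> R) : Prop :=
  forall x, X x ->
    differentiable F x /\ forall j, {for x, continuous (pderiv F j)}.

(* Autonomous first integral on X of dx/dt = A x *)
Definition first_integral (R : realType) (n : nat) (A : 'M[R]_n)
    (X : set 'cV[R]_n) (F : 'cV[R]_n -> R) : Prop :=
  continuously_differentiable X F /\
  forall x, X x -> \sum_(j < n) (A *m x) j 0 * pderiv F j x = 0.

(* Functional independence on X: the Jacobian matrix has full rank p at every
   point of X. *)
Definition functionally_independent (R : realType) (n p : nat)
    (X : set 'cV[R]_n) (F : 'I_p -> 'cV[R]_n -> R) : Prop :=
  forall x, X x -> \rank (\matrix_(i < p, j < n) pderiv (F i) j x) = p.

(** * Complex-valued functions of x in R^n *)

Definition complexify (R : realType) (m n : nat) (M : 'M[R]_(m, n))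
    : 'M[R[i]]_(m, n) :=
  map_mx (real_complex R) M.

Definition ReF (R : realType) (n : nat) (F : 'cV[R]_n -> R[i]) (x : 'cV[R]_n)
    : R := complex.Re (F x).

Definition ImF (R : realType) (n : nat) (F : 'cV[R]_n -> R[i]) (x : 'cV[R]_n)
    : R := complex.Im (F x).

Definition cpderiv (R : realType) (n : nat) (F : 'cV[R]_n -> R[i]) (j : 'I_n)
    (x : 'cV[R]_n) : R[i] :=
  Complex (pderiv (ReF F) j x) (pderiv (ImF F) j x).

Definition complex_first_integral (R : realType) (n : nat) (A : 'M[R]_n)
    (X : set 'cV[R]_n) (F : 'cV[R]_n -> R[i]) : Prop :=
  [/\ continuously_differentiable X (ReF F),
      continuously_differentiable X (ImF F) &
      forall x, X x ->
        \sum_(j < n) complexify (A *m x) j 0 * cpderiv F j x = 0].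

(* The rank is taken over R[i]. *)
Definition complex_functionally_independent (R : realType) (n p : nat)
    (X : set 'cV[R]_n) (F : 'I_p -> 'cV[R]_n -> R[i]) : Prop :=
  forall x, X x -> \rank (\matrix_(i < p, j < n) cpderiv (F i) j x) = p.

(* Main.v *)
(** Solving the triangular system for Psi_k, which is possible as nu^0 x <> 0,
    gives the Psi as rational functions of the forms nu^k x.  The derivative of
    nu^k x along the flow is lambda (nu^k x) + k (nu^(k-1) x).
    Differentiating the system along the flow shows that the derivatives of
    the Psi satisfy the triangular system solved by (1, 0, 0, ...), hence
    Psi_2, Psi_3, ... are first integrals.  Taking gradients instead, the
    vectors nu^k lie in the span of nu^0 and the gradients of Psi_1, Psi_2,
    ...; a Jordan chain being free, these m spanning vectors are independent.
    The real case is the complex one with nu^k regarded as complex. *)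
Require Import Defs.
From mathcomp Require Import all_boot all_order all_algebra.
From mathcomp Require Import all_classical all_reals all_analysis.
From mathcomp Require Import complex.
From mathcomp Require Import ring.

Set Implicit Arguments.
Unset Strict Implicit.
Unset Printing Implicit Defensive.

Import Order.TTheory GRing.Theory Num.Theory.
Import numFieldNormedType.Exports.

Local Open Scope classical_set_scope.
Local Open Scope ring_scope.

(** * Triangular binomial systems over a field *)

(** At a fixed x this is the right-hand side of the functional system, with [y k] for nu^k x. In
    exponential generating functions over characteristic zero the system reads Y' = P Y, so P is the
    logarithmic derivative of Y. *)
Definition binom_conv (K : fieldType) (P y : nat -> K) (k : nat) : K :=
  \sum_(1 <= tau < k.+1) 'C(k.-1, tau.-1)%:R * P tau * y (k - tau)%N.

Lemma binom_conv_recr (K : fieldType) (P y : nat -> K) (k : nat) :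
  (0 < k)%N ->
  binom_conv P y k =
    \sum_(1 <= tau < k) 'C(k.-1, tau.-1)%:R * P tau * y (k - tau)%N
    + P k * y 0%N.
Proof.
by move=> k0; rewrite /binom_conv big_nat_recr//= binn mul1r subnn.
Qed.

(** Forward substitution: once the lower indices agree, only [P k * y 0 = Q k * y 0] is left, and
    [y 0] cancels. *)
Lemma binom_conv_inj (K : fieldType) (P Q y : nat -> K) (m : nat) :
  y 0%N != 0 ->
  (forall k, (0 < k < m)%N -> binom_conv P y k = binom_conv Q y k) ->
  forall k, (0 < k < m)%N -> P k = Q k.
Proof.
move=> y0 PQ k; have [p] := ubnP k; elim: p k => // p IH k kp /andP[k0 km].
have := PQ k; rewrite k0 km => /(_ isT).
rewrite !binom_conv_recr//.
rewrite (eq_big_nat _ _ (F2 := fun tau =>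
  'C(k.-1, tau.-1)%:R * Q tau * y (k - tau)%N)); last first.
  move=> tau /andP[tau0 tauk].
  by rewrite (IH tau (leq_trans tauk kp)) // tau0 (ltn_trans tauk).
by move=> /addrI /(mulIf y0).
Qed.

Definition solve_step (K : fieldType) (y P : nat -> K) (k : nat) : K :=
  (y k - \sum_(1 <= tau < k) 'C(k.-1, tau.-1)%:R * P tau * y (k - tau)%N)
  / y 0%N.

(** Course-of-values recursion: each step from the zero sequence settles one more index, so k + 1
    steps settle index k. *)
Definition solve (K : fieldType) (y : nat -> K) (k : nat) : K :=
  iter k.+1 (solve_step y) (fun=> 0) k.

(** A step at k reads only indices below k, so the value at an index stops changing once the number
    of iterations exceeds it. *)
Lemma solveE (K : fieldType) (y : nat -> K) (k : nat) :
  solve y k = solve_step y (solve y) k.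
Proof.
have stable : forall k' N M, (k' < N)%N -> (k' < M)%N ->
    iter N (solve_step y) (fun=> 0) k' = iter M (solve_step y) (fun=> 0) k'.
  move=> k'; have [p] := ubnP k'; elim: p k' => // p IH k' k'p.
  case=> // N; case=> // M k'N k'M; rewrite !iterS /solve_step.
  congr ((_ - _) / _); apply: eq_big_nat => tau /andP[_ tauk].
  by rewrite (IH tau (leq_trans tauk k'p) N M) ?(leq_trans tauk).
rewrite {1}/solve iterS /solve_step; congr ((_ - _) / _).
by apply: eq_big_nat => tau /andP[_ tauk]; rewrite (stable tau k tau.+1).
Qed.

Lemma binom_conv_solve (K : fieldType) (y : nat -> K) (k : nat) :
  y 0%N != 0 -> (0 < k)%N -> binom_conv (solve y) y k = y k.
Proof.
move=> y0 k0; rewrite binom_conv_recr// (solveE y k) /solve_step.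
by rewrite divfK// addrC subrK.
Qed.

(** [solve y k] is a rational expression in the [y j] with integer coefficients. For the embedding
    of R into R[i] this shows that real data have a real solution. *)
Lemma rmorph_solve (K L : fieldType) (f : {rmorphism K -> L}) (y : nat -> K)
    (k : nat) :
  solve (fun j => f (y j)) k = f (solve y k).
Proof.
have [p] := ubnP k; elim: p k => // p IH k kp.
rewrite !solveE /solve_step fmorph_div rmorphB rmorph_sum.
congr ((_ - _) / _); apply: eq_big_nat => tau /andP[_ tauk].
by rewrite 2!rmorphM rmorph_nat (IH tau (leq_trans tauk kp)).
Qed.

(* If y' is the derivative of y along the flow and P solves the system, then
   dP, the derivative of P, satisfies the same triangular system as the
   sequence (1, 0, 0, ...): the terms containing lambda cancel, and
   (k - tau) C(k-1, tau-1) = (k-1) C(k-2, tau-1) sums the others. *)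
Lemma solve_derivation (K : fieldType) (lambda : K) (m : nat)
    (y y' P dP : nat -> K) :
  y 0%N != 0 ->
  (forall k, (0 < k < m)%N -> binom_conv P y k = y k) ->
  y' 0%N = lambda * y 0%N ->
  (forall k, (0 < k < m)%N -> y' k = lambda * y k + k%:R * y k.-1) ->
  (forall k, (0 < k < m)%N ->
     y' k = binom_conv dP y k + binom_conv P y' k) ->
  forall k, (0 < k < m)%N -> dP k = (k == 1%N)%:R.
Proof.
move=> y0 Py y'0 y'S dPy; apply: (binom_conv_inj (y := y)) => // k /andP[k0 km].
(* Convolution with (1, 0, 0, ...) shifts y by one index, so this is the value to reach; it arises
   as k y_(k-1) minus (k-1) y_(k-1). *)
have -> : binom_conv dP y k = y k.-1.
  have := dPy k; rewrite k0 km => /(_ isT).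
  suff -> : binom_conv P y' k = lambda * y k + (k.-1)%:R * y k.-1.
    rewrite y'S ?k0// => E; apply: (addIr (lambda * y k + k.-1%:R * y k.-1)).
    have kE : k%:R = 1 + k.-1%:R :> K by rewrite nat1r prednK.
    by rewrite -E kE mulrDl mul1r addrCA.
  transitivity (lambda * binom_conv P y k +
      \sum_(1 <= tau < k) (k.-1)%:R * ('C(k.-2, tau.-1)%:R * P tau
                                  * y (k.-1 - tau)%N)).
    rewrite !binom_conv_recr// y'0 mulrDr mulr_sumr [RHS]addrAC -big_split/=.
    congr (_ + _); last by rewrite mulrCA.
    apply: eq_big_nat => tau /andP[tau0 tauk].
    rewrite y'S; last first.
      by rewrite subn_gt0 tauk (leq_ltn_trans _ km)// leq_subr.
    rewrite mulrDr mulrCA; congr (_ + _).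
    rewrite (_ : (k - tau).-1 = (k.-1 - tau)%N); last first.
      by case: k k0 tauk {dPy km} => // k _ tauk; rewrite /= subSKn.
    rewrite !mulrA; congr (_ * _); rewrite -natrM mulrAC -natrM.
    congr (_%:R * _).
    case: k k0 tauk {dPy km} => // k _; case: tau tau0 => // tau _ /=.
    rewrite ltnS subSS => tauk; case: k tauk => // k tauk /=.
    by rewrite mul_bin_down mulnC.
  rewrite Py ?k0//; congr (_ + _); rewrite -mulr_sumr.
  (* The system says nothing at index 0, but for k = 1 the factor k - 1 vanishes. *)
  have [->|k1] := eqVneq k 1%N; first by rewrite mul0r mul0r.
  have k2 : (0 < k.-1)%N by case: k k0 k1 {km dPy} => // -[].
  rewrite -(Py k.-1) ?k2 ?(leq_ltn_trans (leq_pred _) km)//.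
  by rewrite /binom_conv prednK.
rewrite /binom_conv big_nat_recl//= bin0 !mul1r subn1 big_nat big1 ?addr0//.
by move=> tau /andP[tau0 _]; rewrite eqSS eqn0Ngt tau0 mulr0 mul0r.
Qed.

(** * Freeness of Jordan chains and ranks *)

(** Applying [B - lambda%:M] to a vanishing combination kills nu^0 and shifts the rest, with
    coefficients (j+1) c_(j+1). Induction and characteristic zero give c_(j+1) = 0, then c_0 = 0 as
    nu^0 is non-zero. *)
Lemma jordan_chain_free (K : numFieldType) (n : nat) (B : 'M[K]_n)
    (lambda : K) (m : nat) (nu : nat -> 'cV[K]_n) :
  generalized_eigenvectors B lambda m nu ->
  forall p (c : nat -> K), (p <= m)%N ->
    \sum_(k < p) c k *: nu k = 0 -> forall k, (k < p)%N -> c k = 0.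
Proof.
move=> [nu0 eig0 eigS]; elim=> // p IH c pm sum0.
have cS k : (k < p)%N -> c k.+1 = 0.
  move=> kp; have := IH (fun j => j.+1%:R * c j.+1) (ltnW pm).
  suff /[swap] /[apply] /(_ k kp) : \sum_(j < p) (j.+1%:R * c j.+1) *: nu j = 0.
    by move=> /eqP; rewrite mulf_eq0 pnatr_eq0 => /eqP.
  have /(congr1 (mulmx (B - lambda%:M))) := sum0.
  rewrite mulmx0 mulmx_sumr big_ord_recl/= -scalemxAr mulmxBl eig0.
  rewrite mul_scalar_mx subrr scaler0 add0r => S0; rewrite -[RHS]S0.
  apply: eq_bigr => j _; rewrite -scalemxAr.
  have [|_ ->/=] := eigS j.+1; first by rewrite (leq_trans _ pm)// ltnS.
  by rewrite scalerA mulrC.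
have : c 0%N *: nu 0%N = 0.
  move: sum0; rewrite big_ord_recl big1 ?addr0// => j _ /=.
  by rewrite cS// scale0r.
move=> /eqP; rewrite scaler_eq0 (negbTE nu0) orbF => /eqP c0.
by case=> // k; rewrite ltnS => /cS.
Qed.

(** The selected rows are a selection matrix times M. As f is injective, entry [f i] of v times the
    selection matrix is [v i], so that matrix is row-free. *)
Lemma rank_rowsub_free (K : fieldType) (p m n : nat) (f : 'I_p -> 'I_m)
    (M : 'M[K]_(m, n)) :
  injective f -> row_free M -> \rank (rowsub f M) = p.
Proof.
move=> fI Mfree.
have -> : rowsub f M = rowsub f 1%:M *m M by rewrite mul_rowsub_mx mul1mx.
rewrite mxrankMfree//; apply/eqP/inj_row_free => v v0.
apply/rowP => i; move/rowP: v0 => /(_ (f i)); rewrite !mxE => v0.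
rewrite -v0 (bigD1 i)//= !mxE eqxx mulr1 big1 ?addr0// => j ji.
by rewrite !mxE (inj_eq fI) (negbTE ji) mulr0.
Qed.

(** * Gradient calculus for real-valued functions *)

Section Gradient.
Variables (R : realType) (n : nat).
Implicit Types (f : 'cV[R]_n -> R) (g : 'I_n -> 'cV[R]_n -> R) (x : 'cV[R]_n).

(** [g] is a formula on the whole space, compared with the gradient only at x; if it serves at every
    point of an open set, [f] is continuously differentiable there. *)
Definition has_gradient f g x : Prop :=
  differentiable f x /\
  forall j, pderiv f j x = g j x /\ {for x, continuous (g j)}.

Lemma has_gradient_cst (a : R) x :
  has_gradient (fun=> a) (fun _ _ => 0) x.
Proof.
split; first exact: differentiable_cst.
by move=> j; split; [rewrite /pderiv; exact: derive_cst | exact: cst_continuous].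
Qed.

Lemma has_gradient_coord (i : 'I_n) x :
  has_gradient (fun y => y i 0) (fun j _ => (i == j)%:R) x.
Proof.
split; first exact: differentiable_coord.
move=> j; split; last exact: cst_continuous.
rewrite /pderiv /derive; apply: cvg_lim => //.
(* The difference quotient is constant for h <> 0. *)
apply: cvg_near_cst; near=> h.
rewrite /= !mxE addrK eqxx andbT [LHS]mulrA mulVf ?mul1r//.
by near: h; exact: nbhs_dnbhs_neq.
Unshelve. all: by end_near. Qed.

Lemma has_gradientD f1 g1 f2 g2 x :
  has_gradient f1 g1 x -> has_gradient f2 g2 x ->
  has_gradient (fun y => f1 y + f2 y) (fun j y => g1 j y + g2 j y) x.
Proof.
move=> [d1 h1] [d2 h2]; split; first exact: differentiableD.
move=> j; have [p1 c1] := h1 j; have [p2 c2] := h2 j; split.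
  by rewrite -p1 -p2 /pderiv; apply: deriveD; exact: diff_derivable.
exact: (cvgD c1 c2).
Qed.

Lemma has_gradientM f1 g1 f2 g2 x :
  has_gradient f1 g1 x -> has_gradient f2 g2 x ->
  has_gradient (fun y => f1 y * f2 y)
               (fun j y => g1 j y * f2 y + f1 y * g2 j y) x.
Proof.
move=> [d1 h1] [d2 h2]; split; first exact: differentiableM.
have := differentiable_continuous d1; have := differentiable_continuous d2.
move=> k2 k1 j; have [p1 c1] := h1 j; have [p2 c2] := h2 j; split.
  rewrite -p1 -p2 /pderiv [LHS]deriveM; try exact: diff_derivable.
  by rewrite addrC [X in _ = X + _]mulrC.
exact: (cvgD (cvgM c1 k2) (cvgM k1 c2)).
Qed.

Lemma has_gradientV f g x :
  f x != 0 -> has_gradient f g x ->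
  has_gradient (fun y => (f y)^-1) (fun j y => - g j y / f y ^+ 2) x.
Proof.
move=> fx0 [d h]; split; first exact: differentiableV.
have k := differentiable_continuous d.
move=> j; have [p c] := h j; split.
  rewrite -p /pderiv deriveV//; last exact: diff_derivable.
  by rewrite [LHS]mulNr [RHS]mulNr [in LHS]mulrC.
have cN : (fun y => - g j y) @ x --> - g j x by exact: (cvgN c).
have c2 : (fun y => f y ^+ 2) @ x --> f x ^+ 2 by exact: (cvgM k k).
exact: (cvgM cN (cvgV (expf_neq0 _ fx0) c2)).
Qed.

Lemma has_gradientN f g x :
  has_gradient f g x -> has_gradient (fun y => - f y) (fun j y => - g j y) x.
Proof.
move=> [d h]; split; first exact: differentiableN.
move=> j; have [p c] := h j; split; last exact: (cvgN c).
by rewrite -p /pderiv deriveN//; exact: diff_derivable.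
Qed.

Lemma has_gradient_eq f g f' g' x :
  f =1 f' -> (forall j, g j =1 g' j) ->
  has_gradient f g x -> has_gradient f' g' x.
Proof.
move=> /funext <- gg'; suff -> : g' = g by [].
by apply/funext => j; apply/funext => y; rewrite gg'.
Qed.

Lemma has_gradient_C1 (X : set 'cV[R]_n) f g :
  open X -> (forall x, X x -> has_gradient f g x) ->
  continuously_differentiable X f.
Proof.
move=> oX fg x Xx; have [df h] := fg x Xx; split=> // j.
have [e c] := h j; rewrite /prop_for /continuous_at e.
apply: cvg_trans c.
(* On X, a neighbourhood of x, the partial derivative coincides with [g j] and so inherits its
   continuity. *)
have gE : \forall y \near nbhs x, g j y = pderiv f j y.
  have : nbhs x X by exact: open_nbhs_nbhs.
  by apply: filterS => y /fg[_ /(_ j)[]].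
exact: (near_eq_cvg gE).
Qed.

End Gradient.

(** * Gradient calculus for complex-valued functions, through real and imaginary parts *)

Section ComplexGradient.
Variables (R : realType) (n : nat).
Implicit Types (F : 'cV[R]_n -> R[i]) (G : 'I_n -> 'cV[R]_n -> R[i]).
Implicit Types (x : 'cV[R]_n) (X : set 'cV[R]_n).

Definition has_cgradient F G x : Prop :=
  has_gradient (ReF F) (fun j => ReF (G j)) x /\
  has_gradient (ImF F) (fun j => ImF (G j)) x.

Lemma has_cgradientE F G x j : has_cgradient F G x -> cpderiv F j x = G j x.
Proof.
move=> [[_ /(_ j)[re _]] [_ /(_ j)[im _]]].
by rewrite /cpderiv re im /ReF /ImF; case: (G j x).
Qed.

Lemma has_cgradient_cst (a : R[i]) x :
  has_cgradient (fun=> a) (fun _ _ => 0) x.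
Proof. by split; exact: has_gradient_cst. Qed.

Lemma has_cgradient_coord (i : 'I_n) x :
  has_cgradient (fun y => complexify y i 0) (fun j _ => (i == j)%:R) x.
Proof.
split.
  apply: has_gradient_eq (has_gradient_coord i x) => [y|j y].
    by rewrite /ReF mxE.
  by rewrite /ReF; case: eqP.
apply: has_gradient_eq (has_gradient_cst 0 x) => [y|j y].
  by rewrite /ImF mxE.
by rewrite /ImF; case: eqP.
Qed.

Lemma has_cgradientD F1 G1 F2 G2 x :
  has_cgradient F1 G1 x -> has_cgradient F2 G2 x ->
  has_cgradient (fun y => F1 y + F2 y) (fun j y => G1 j y + G2 j y) x.
Proof.
move=> [r1 i1] [r2 i2]; split.
  apply: has_gradient_eq (has_gradientD r1 r2) => [y|j y]; rewrite /ReF.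
    by case: (F1 y) (F2 y) => ? ? [].
  by case: (G1 j y) (G2 j y) => ? ? [].
apply: has_gradient_eq (has_gradientD i1 i2) => [y|j y]; rewrite /ImF.
  by case: (F1 y) (F2 y) => ? ? [].
by case: (G1 j y) (G2 j y) => ? ? [].
Qed.

Lemma has_cgradientM F1 G1 F2 G2 x :
  has_cgradient F1 G1 x -> has_cgradient F2 G2 x ->
  has_cgradient (fun y => F1 y * F2 y)
                (fun j y => G1 j y * F2 y + F1 y * G2 j y) x.
Proof.
move=> [r1 i1] [r2 i2]; split.
  apply: has_gradient_eq (has_gradientD (has_gradientM r1 r2)
    (has_gradientN (has_gradientM i1 i2))) => [y|j y]; rewrite /ReF /ImF.
    by case: (F1 y) (F2 y) => ? ? [].
  case: (F1 y) (F2 y) (G1 j y) (G2 j y) => ? ? [? ?] [? ?] [? ?] /=.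
  by rewrite opprD addrACA.
apply: has_gradient_eq (has_gradientD (has_gradientM r1 i2)
  (has_gradientM i1 r2)) => [y|j y]; rewrite /ReF /ImF.
  by case: (F1 y) (F2 y) => ? ? [].
case: (F1 y) (F2 y) (G1 j y) (G2 j y) => ? ? [? ?] [? ?] [? ?] /=.
ring.
Qed.

(** Rests on 1/(a + bi) = (a - bi)/(a^2 + b^2) and the real rule for the inverse of a^2 + b^2. *)
Lemma has_cgradientV F G x :
  F x != 0 -> has_cgradient F G x ->
  has_cgradient (fun y => (F y)^-1) (fun j y => - G j y / F y ^+ 2) x.
Proof.
move=> Fx0 [r i].
have sq0 (a b : R) : (a ^+ 2 + b ^+ 2 == 0) = (a == 0) && (b == 0).
  by rewrite paddr_eq0 ?sqr_ge0// !sqrf_eq0.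
have N0 : ReF F x * ReF F x + ImF F x * ImF F x != 0.
  move: Fx0; rewrite /ReF /ImF; case: (F x) => a b /=.
  by rewrite -!expr2 sq0 eq_complex.
have N := has_gradientV N0 (has_gradientD (has_gradientM r r)
                                          (has_gradientM i i)).
split.
  apply: has_gradient_eq (has_gradientM r N) => [y|j y]; rewrite /ReF /ImF.
    by case: (F y) => a b /=; rewrite -!expr2.
  rewrite -(exprVn (F y)) expr2; case: (F y) (G j y) => a b [c d] /=.
  (* The two formulas must agree at every y, even at zeros of F; there both are 0 since the inverse
     of 0 is 0. *)
  have [|ab0] := boolP (a ^+ 2 + b ^+ 2 == 0).
    rewrite sq0 => /andP[/eqP -> /eqP ->].
    by rewrite ?(expr0n, mul0r, mulr0, addr0, invr0, oppr0).
  by field.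
apply: has_gradient_eq (has_gradientN (has_gradientM i N)) => [y|j y];
    rewrite /ReF /ImF.
  by case: (F y) => a b /=; rewrite -!expr2.
rewrite -(exprVn (F y)) expr2; case: (F y) (G j y) => a b [c d] /=.
have [|ab0] := boolP (a ^+ 2 + b ^+ 2 == 0).
  rewrite sq0 => /andP[/eqP -> /eqP ->].
  by rewrite ?(expr0n, mul0r, mulr0, addr0, invr0, oppr0).
by field.
Qed.

End ComplexGradient.

(** * Differentiating the solution of the triangular system *)

Section SolutionGradient.
Variables (R : realType) (n : nat).
Implicit Types (F : 'cV[R]_n -> R[i]) (G : 'I_n -> 'cV[R]_n -> R[i]).
Implicit Types (x : 'cV[R]_n) (X : set 'cV[R]_n).

Lemma has_cgradient_eq F G F' G' x :
  F =1 F' -> (forall j, G j =1 G' j) ->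
  has_cgradient F G x -> has_cgradient F' G' x.
Proof.
move=> /funext <- GG'; suff -> : G' = G by [].
by apply/funext => j; apply/funext => y; rewrite GG'.
Qed.

Lemma has_cgradientN F G x :
  has_cgradient F G x -> has_cgradient (fun y => - F y) (fun j y => - G j y) x.
Proof.
move=> /(has_cgradientM (has_cgradient_cst (-1) x)).
by apply: has_cgradient_eq => [y|j y]; rewrite ?mul0r ?add0r mulN1r.
Qed.

Lemma has_cgradient_sum (I : eqType) (r : seq I) (F : I -> 'cV[R]_n -> R[i])
    (G : I -> 'I_n -> 'cV[R]_n -> R[i]) x :
  (forall i, i \in r -> has_cgradient (F i) (G i) x) ->
  has_cgradient (fun y => \sum_(i <- r) F i y)
                (fun j y => \sum_(i <- r) G i j y) x.
Proof.
elim: r => [|i r IH] FG.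
  by apply: has_cgradient_eq (has_cgradient_cst 0 x) => [y|j y]; rewrite big_nil.
have FGr : forall i', i' \in r -> has_cgradient (F i') (G i') x.
  by move=> i' i'r; apply: FG; rewrite inE i'r orbT.
have := has_cgradientD (FG i (mem_head i r)) (IH FGr).
by apply: has_cgradient_eq => [y|j y]; rewrite big_cons.
Qed.

Lemma has_cgradient_lform (c : 'cV[R[i]]_n) x :
  has_cgradient (fun y => lform c (complexify y)) (fun j _ => c j 0) x.
Proof.
have h i : has_cgradient (fun y : 'cV[R]_n => c i 0 * complexify y i 0) _ x :=
  has_cgradientM (has_cgradient_cst (c i 0) x) (has_cgradient_coord i x).
apply: has_cgradient_eq (has_cgradient_sum (fun i _ => h i)) => [y|j y] //.
rewrite (bigD1_seq j) ?mem_index_enum ?index_enum_uniq//= eqxx mulr1 mul0r.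
rewrite add0r big1 ?addr0// => i /negbTE ->.
by rewrite mul0r mulr0 addr0.
Qed.

(** Strong induction along the recursion for [solve]; a single formula G is produced for all of
    X. *)
Lemma solve_gradient X (l : nat -> 'cV[R]_n -> R[i])
    (Dl : nat -> 'I_n -> 'cV[R]_n -> R[i]) :
  (forall x, X x -> l 0%N x != 0) ->
  (forall k x, X x -> has_cgradient (l k) (Dl k) x) ->
  forall k, exists G : 'I_n -> 'cV[R]_n -> R[i], forall x, X x ->
    has_cgradient (fun y => solve (l^~ y) k) G x.
Proof.
move=> l0 hl k; have [p] := ubnP k; elim: p k => // p IH k kp.
have /choice[G hG] : forall tau, exists G : 'I_n -> 'cV[R]_n -> R[i],
    forall x, (tau < k)%N -> X x ->
      has_cgradient (fun y => solve (l^~ y) tau) G x.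
  (* For tau >= k the zero function is a dummy that lets choice range over all tau. *)
  move=> tau; have [tauk|] := ltnP tau k; last by exists (fun _ _ => 0).
  by have [G hG] := IH tau (leq_trans tauk kp); exists G => x _; exact: hG.
eexists => x Xx.
have index_iota_ltn tau : tau \in index_iota 1 k -> (tau < k)%N.
  by rewrite mem_index_iota => /andP[].
have hS := has_cgradient_sum (r := index_iota 1 k) (fun tau htau =>
  has_cgradientM (has_cgradientM (has_cgradient_cst 'C(k.-1, tau.-1)%:R x)
    (hG tau x (index_iota_ltn tau htau) Xx))
    (hl (k - tau)%N x Xx)).
apply: has_cgradient_eq (has_cgradientM
  (has_cgradientD (hl k x Xx) (has_cgradientN hS))
  (has_cgradientV (l0 x Xx) (hl 0%N x Xx))) => [y|j y]; last reflexivity.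
by rewrite /= solveE.
Qed.

(** Leibniz rule for the functional system: one convolution differentiates the solution, the other
    the forms. *)
Lemma cpderiv_binom_conv_solve X (l : nat -> 'cV[R]_n -> R[i])
    (Dl : nat -> 'I_n -> 'cV[R]_n -> R[i]) :
  (forall x, X x -> l 0%N x != 0) ->
  (forall k x, X x -> has_cgradient (l k) (Dl k) x) ->
  forall j k x, (0 < k)%N -> X x ->
    Dl k j x =
    binom_conv (fun t => cpderiv (fun y => solve (l^~ y) t) j x) (l^~ x) k +
    binom_conv (solve (l^~ x)) (fun t => Dl t j x) k.
Proof.
move=> l0 hl j k x k0 Xx; have [G hG] := choice (solve_gradient l0 hl).
have hS := has_cgradient_sum (r := index_iota 1 k) (fun tau htau =>
  has_cgradientM (has_cgradientM (has_cgradient_cst 'C(k.-1, tau.-1)%:R x)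
    (hG tau x Xx)) (hl (k - tau)%N x Xx)).
have hk := has_cgradientM
  (has_cgradientD (hl k x Xx) (has_cgradientN hS))
  (has_cgradientV (l0 x Xx) (hl 0%N x Xx)).
have solvek : (fun y => solve (l^~ y) k) =
    (fun y => (l k y - \sum_(1 <= tau < k) 'C(k.-1, tau.-1)%:R
               * solve (l^~ y) tau * l (k - tau)%N y) / l 0%N y).
  by apply/funext => y; rewrite solveE.
(* Only the solution of top index is unfolded; its quotient rule, multiplied by [l 0], supplies the
   remaining terms. *)
rewrite !binom_conv_recr// [in X in _ = _ + X + _]solvek.
rewrite (has_cgradientE j hk) [solve _ k]solveE /solve_step.
under eq_bigr => tau _ do rewrite (has_cgradientE j (hG tau x Xx)).
under [in X in (_ - X) / _]eq_bigr do rewrite mul0r add0r.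
rewrite big_split/=.
by field; exact: l0.
Qed.

End SolutionGradient.

(** * Linear forms, unique solvability and independence of the gradients *)

Lemma lformE (K : fieldType) (n : nat) (c x : 'cV[K]_n) :
  lform c x = (c^T *m x) 0 0.
Proof. by rewrite mxE; apply: eq_bigr => j _; rewrite mxE. Qed.

Lemma lform_mulmx (K : fieldType) (n : nat) (B : 'M[K]_n) (c x : 'cV[K]_n) :
  lform c (B *m x) = lform (B^T *m c) x.
Proof. by rewrite !lformE trmx_mul trmxK mulmxA. Qed.

Lemma generalized_eigenvectorsE (K : fieldType) (n : nat) (B : 'M[K]_n)
    (lambda : K) (m : nat) (nu : nat -> 'cV[K]_n) (k : nat) :
  generalized_eigenvectors B lambda m nu -> (0 < k < m)%N ->
  B *m nu k = lambda *: nu k + k%:R *: nu k.-1.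
Proof.
move=> [_ _ /(_ k) h] /h[_ <-].
by rewrite mulmxBl mul_scalar_mx addrC subrK.
Qed.

Lemma unique_solution_solve (K : fieldType) (T : Type) (X : set T) (m : nat)
    (l : nat -> T -> K) :
  (forall x, X x -> l 0%N x != 0) ->
  unique_solution X m l (fun k x => solve (l^~ x) k).
Proof.
move=> l0; split=> [x Xx k /andP[k0 _]|Phi PhiP x Xx].
  exact/esym/binom_conv_solve/k0/l0.
apply: (binom_conv_inj (y := l^~ x) (l0 x Xx)) => k km.
transitivity (l k x); first by exact: esym (PhiP x Xx k km).
by rewrite binom_conv_solve ?l0//; case/andP: km.
Qed.

(** The differentiated system places every nu^k in the row space of D, whose rows are nu^0 and
    [dP 1], ..., [dP (m - 1)]. The nu^k being m free vectors, the m rows of D are free as well. *)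
Lemma functional_independence_solve (K : numFieldType) (n : nat) (B : 'M[K]_n)
    (lambda : K) (m : nat) (nu : nat -> 'cV[K]_n) (y P : nat -> K)
    (dP : nat -> 'I_n -> K) :
  generalized_eigenvectors B lambda m nu ->
  (forall k j, (0 < k < m)%N ->
     nu k j 0 = binom_conv (dP^~ j) y k + binom_conv P (fun t => nu t j 0) k) ->
  \rank (\matrix_(i < m - 2, j < n) dP (i + 2)%N j) = (m - 2)%N.
Proof.
move=> gnu rel.
pose N : 'M[K]_(m, n) := \matrix_(k < m, j < n) nu k j 0.
pose D : 'M[K]_(m, n) :=
  \matrix_(k < m, j < n) if k == 0%N :> nat then nu 0%N j 0 else dP k j.
have Nfree : row_free N.
  apply/inj_row_free => v vN; apply/rowP => i; rewrite mxE.
  (* The row v is extended by 0 to a sequence of coefficients. *)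
  pose c k := oapp (v 0) 0 (insub k : option 'I_m).
  have cE (k : 'I_m) : c k = v 0 k by rewrite /c valK.
  rewrite -cE; apply: (jordan_chain_free gnu (leqnn m)) => //.
  apply/colP => j; rewrite summxE mxE.
  move/rowP: vN => /(_ j); rewrite !mxE => vN.
  by rewrite -[RHS]vN; apply: eq_bigr => k _; rewrite !mxE cE.
have rowN k : (k < m)%N -> (\row_j nu k j 0 <= D)%MS.
  have [p] := ubnP k; elim: p k => // p IH k kp km.
  have [->|k0] := eqVneq k 0%N.
    have m0 : (0 < m)%N by rewrite (leq_ltn_trans _ km).
    rewrite (_ : \row_j _ = row (Ordinal m0) D) ?row_sub//.
    by apply/rowP => j; rewrite !mxE.
  rewrite -lt0n in k0.
  (* Since tau >= 1, each summand involves a row of D and a vector of index below k. *)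
  have -> : \row_j nu k j 0 = \sum_(1 <= tau < k.+1)
      (('C(k.-1, tau.-1)%:R * y (k - tau)%N) *: (\row_j dP tau j)
       + ('C(k.-1, tau.-1)%:R * P tau) *: (\row_j nu (k - tau)%N j 0)).
    apply/rowP => j; rewrite summxE !mxE rel ?k0// -big_split.
    by apply: eq_bigr => tau _; rewrite !mxE mulrAC.
  rewrite big_nat; apply: summx_sub => tau /andP[tau0 tauk].
  have taum : (tau < m)%N by rewrite (leq_trans tauk).
  apply: addmx_sub; apply: scalemx_sub; last first.
    apply: IH; last by rewrite (leq_ltn_trans (leq_subr _ _)).
    by rewrite (leq_trans _ (kp : (k <= p)%N))// ltn_subrL tau0 k0.
  rewrite (_ : \row_j _ = row (Ordinal taum) D) ?row_sub//.
  by apply/rowP => j; rewrite !mxE/= eqn0Ngt tau0.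
have Dfree : row_free D.
  rewrite /row_free eqn_leq rank_leq_row -{1}(eqP Nfree) mxrankS//.
  apply/row_subP => k; rewrite (_ : row k N = \row_j nu k j 0) ?rowN//.
  by apply/rowP => j; rewrite !mxE.
(* The shift by 2 drops the rows nu^0 and [dP 1]. *)
have lt2 (i : 'I_(m - 2)) : (i + 2 < m)%N by rewrite addnC -ltn_subRL.
have injf : injective (fun i => Ordinal (lt2 i)).
  by move=> i i' /(congr1 val)/= /addIn/val_inj.
rewrite -[RHS](rank_rowsub_free injf Dfree).
by congr (\rank _); apply/matrixP => i j; rewrite !mxE/= addn2.
Qed.

(** * First integrals: the complex case, then the real one *)

Lemma has_cgradient_C1 (R : realType) (n : nat) (X : set 'cV[R]_n)
    (F : 'cV[R]_n -> R[i]) (G : 'I_n -> 'cV[R]_n -> R[i]) :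
  open X -> (forall x, X x -> has_cgradient F G x) ->
  continuously_differentiable X (ReF F) /\
  continuously_differentiable X (ImF F).
Proof.
by move=> oX FG; split; apply: has_gradient_C1 oX _ => x /FG[re im];
  [exact: re | exact: im].
Qed.

(** The components of A x are real, so the complex identity splits into the identities for the two
    parts. *)
Lemma complex_first_integral_ReIm (R : realType) (n : nat) (A : 'M[R]_n)
    (X : set 'cV[R]_n) (F : 'cV[R]_n -> R[i]) :
  complex_first_integral A X F ->
  first_integral A X (ReF F) /\ first_integral A X (ImF F).
Proof.
move=> [re im sum0].
have ReImD (h : 'I_n -> R[i]) : \sum_j h j =
    Complex (\sum_j complex.Re (h j)) (\sum_j complex.Im (h j)).
  elim/big_rec3: _ => //= j a b c _ ->.
  by case: (h j).
have cE (a b c : R) : Complex a 0 * Complex b c = Complex (a * b) (a * c).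
  by apply/eqP; rewrite eq_complex/= !mul0r subr0 addr0 !eqxx.
split; split=> // x Xx; have := sum0 x Xx; rewrite ReImD => -[].
  by move=> + _; under eq_bigr do rewrite mxE cE.
by move=> _; under eq_bigr do rewrite mxE cE.
Qed.

(** Linearity turns the Leibniz rules for partial derivatives into one along a vector v. *)
Lemma binom_conv_suml (K : fieldType) (n : nat) (v : 'I_n -> K)
    (P : nat -> 'I_n -> K) (y : nat -> K) (k : nat) :
  binom_conv (fun t => \sum_j v j * P t j) y k =
  \sum_j v j * binom_conv (P^~ j) y k.
Proof.
under [RHS]eq_bigr do rewrite mulr_sumr.
rewrite exchange_big; apply: eq_bigr => tau _.
rewrite mulr_sumr mulr_suml; apply: eq_bigr => j _.
by rewrite mulrCA !mulrA.
Qed.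

Lemma binom_conv_sumr (K : fieldType) (n : nat) (v : 'I_n -> K)
    (P : nat -> K) (y : nat -> 'I_n -> K) (k : nat) :
  binom_conv P (fun t => \sum_j v j * y t j) k =
  \sum_j v j * binom_conv P (y^~ j) k.
Proof.
under [RHS]eq_bigr do rewrite mulr_sumr.
rewrite exchange_big; apply: eq_bigr => tau _.
by rewrite mulr_sumr; apply: eq_bigr => j _; rewrite mulrCA.
Qed.

Lemma complex_first_integrals (R : realType) (n m : nat) (A : 'M[R]_n)
    (lambda : R[i]) (nu : nat -> 'cV[R[i]]_n) (X : set 'cV[R]_n)
    (l := fun k x => lform (nu k) (complexify x))
    (Psi := fun k x => solve (l^~ x) k) :
  generalized_eigenvectors (complexify A)^T lambda m nu ->
  open X -> (forall x, X x -> l 0%N x != 0) ->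
  (forall zeta, (2 <= zeta < m)%N -> complex_first_integral A X (Psi zeta)) /\
  complex_functionally_independent X (fun i : 'I_(m - 2) => Psi (i + 2)%N).
Proof.
move=> gnu oX l0.
have hl k x : X x -> has_cgradient (l k) (fun j _ => nu k j 0) x.
  by move=> _; exact: has_cgradient_lform.
have dl j k x : (0 < k)%N -> X x -> nu k j 0 =
    binom_conv (fun t => cpderiv (Psi t) j x) (l^~ x) k +
    binom_conv (Psi^~ x) (fun t => nu t j 0) k.
  exact: (cpderiv_binom_conv_solve l0 hl).
split=> [zeta /andP[zeta2 zetam]|x Xx]; last first.
  apply: (functional_independence_solve (y := l^~ x) (P := Psi^~ x)
    (dP := fun t j => cpderiv (Psi t) j x) gnu) => k j /andP[k0 _].
  exact: dl.
have [G /(has_cgradient_C1 oX)[re im]] := solve_gradient l0 hl zeta.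
split=> // x Xx.
pose v j := complexify (A *m x) j 0.
(* The derivative of nu^k x along the flow is (A^T nu^k) x. *)
have lv k : \sum_j v j * nu k j 0 = lform ((complexify A)^T *m nu k) (complexify x).
  rewrite -lform_mulmx /lform; apply: eq_bigr => j _.
  by rewrite mulrC /v /complexify map_mxM.
have lD (c d : 'cV[R[i]]_n) (a b : R[i]) z :
    lform (a *: c + b *: d) z = a * lform c z + b * lform d z.
  by rewrite !lformE linearP/= linearZ/= mulmxDl -!scalemxAl !mxE.
(* The flow derivatives of the Psi are (1, 0, 0, ...), and zeta >= 2. *)
transitivity ((zeta == 1%N)%:R : R[i]); last by case: zeta zeta2 {zetam re im G} => [|[]].
apply: (solve_derivation (lambda := lambda) (m := m) (y := l^~ x)
  (y' := fun k => \sum_j v j * nu k j 0) (P := Psi^~ x)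
  (dP := fun t => \sum_j v j * cpderiv (Psi t) j x)).
- exact: l0.
- by move=> k /andP[k0 _]; apply: binom_conv_solve; rewrite ?l0.
- rewrite lv; case: gnu => _ -> _.
  by rewrite -[_ *: _]addr0 -[X in _ + X](scale0r 0) lD mul0r addr0.
- by move=> k km; rewrite lv (generalized_eigenvectorsE gnu)// lD.
- move=> k /andP[k0 _].
  rewrite binom_conv_suml binom_conv_sumr -big_split; apply: eq_bigr => j _.
  by rewrite /= -mulrDr -dl.
- by rewrite zetam (ltn_trans _ zeta2).
Qed.

(* First conjunct: lambda and the vectors nu k are real and the Psi are
   real-valued.  Second conjunct: lambda is any complex eigenvalue (in
   particular one with Im lambda <> 0) and the Psi are complex-valued.  The
   index i : 'I_(m - 2) stands for zeta = i + 2. *)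
Theorem theorem1p8 (R : realType) (n m : nat) (A : 'M[R]_n) (hm : (2 <= m)%N) :
  (forall (lambda : R) (nu : nat -> 'cV[R]_n) (X : set 'cV[R]_n),
     elementary_divisor A^T lambda m ->
     generalized_eigenvectors A^T lambda m nu ->
     domain X ->
     X `<=` [set x | lform (nu 0%N) x != 0] ->
     exists Psi : nat -> 'cV[R]_n -> R,
       [/\ unique_solution X m (fun k x => lform (nu k) x) Psi,
           forall zeta, (2 <= zeta < m)%N -> first_integral A X (Psi zeta) &
           functionally_independent X
             (fun i : 'I_(m - 2) => Psi (i + 2)%N)]) /\
  (forall (lambda : R[i]) (nu : nat -> 'cV[R[i]]_n) (X : set 'cV[R]_n),
     elementary_divisor (complexify A)^T lambda m ->
     generalized_eigenvectors (complexify A)^T lambda m nu ->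
     domain X ->
     X `<=` [set x | lform (nu 0%N) (complexify x) != 0] ->
     exists Psi : nat -> 'cV[R]_n -> R[i],
       [/\ unique_solution X m (fun k x => lform (nu k) (complexify x)) Psi,
           forall zeta, (2 <= zeta < m)%N ->
             [/\ complex_first_integral A X (Psi zeta),
                 first_integral A X (ReF (Psi zeta)) &
                 first_integral A X (ImF (Psi zeta))] &
           complex_functionally_independent X
             (fun i : 'I_(m - 2) => Psi (i + 2)%N)]).
Proof.
split=> [lambda nu X _ gnu [oX _] X0|lambda nu X _ gnu [oX _] X0]; last first.
  have [fi ind] := complex_first_integrals gnu oX X0.
  eexists; split; [exact: unique_solution_solve X0 | | exact: ind].
  move=> zeta /fi cfi; have [re im] := complex_first_integral_ReIm cfi.
  by split.
have lC k x : lform (complexify (nu k)) (complexify x) = (lform (nu k) x)%:C%C.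
  by rewrite /lform rmorph_sum; apply: eq_bigr => j _; rewrite !mxE rmorphM.
have gnuC : generalized_eigenvectors (complexify A)^T lambda%:C%C m
    (fun k => complexify (nu k)).
  have [nu0 eig0 eigS] := gnu; split.
  - by rewrite map_mx_eq0.
  - by rewrite /complexify map_trmx -map_mxM eig0 map_mxZ.
  - move=> k /eigS[nuk eigk]; split; first by rewrite map_mx_eq0.
    rewrite /complexify map_trmx -map_scalar_mx -map_mxB -map_mxM eigk map_mxZ.
    by rewrite rmorph_nat.
have X0C x : X x -> lform (complexify (nu 0%N)) (complexify x) != 0.
  by move=> /X0; rewrite lC fmorph_eq0.
have [fi ind] := complex_first_integrals gnuC oX X0C.
(* The solution for the complexified vectors is the real solution embedded in R[i], so its real part
   is the required Psi. *)
have PsiC zeta : (fun x => solve (fun k => lform (complexify (nu k))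
                                                 (complexify x)) zeta)
    = fun x => (solve (fun k => lform (nu k) x) zeta)%:C%C.
  apply/funext => x; rewrite -rmorph_solve; congr (solve _ zeta).
  by apply/funext => k; rewrite lC.
eexists; split; first exact: unique_solution_solve X0.
  move=> zeta /fi; rewrite PsiC => /complex_first_integral_ReIm[].
  by [].
(* Rank is invariant under field extension, and the complex Jacobian is the embedded real one
   because the imaginary parts vanish identically. *)
move=> x Xx; rewrite -[RHS](ind x Xx) -(mxrank_map (real_complex R)).
congr (\rank _); apply/matrixP => i j; rewrite !mxE PsiC.
apply/eqP; rewrite eq_complex; apply/andP; split; apply/eqP => //=.
by rewrite /pderiv [ImF _](_ : _ = cst 0)// derive_cst.
Qed.
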